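(* Let $\alpha\in[0,1)$ and define $f(\alpha)=6$ if $\alpha\in[0,\tfrac{2}{3}]$ and $f(\alpha)=\frac{4}{1-\alpha}$ if $\alpha\in(\tfrac{2}{3},1)$. Let $G$ be a connected graph of order $n$ with $n\geq f(\alpha)$. If $\rho_{\alpha}(G)\geq\rho_{\alpha}(K_1\vee(K_{n-2}\cup K_1))$, then $G$ is $1$-tough unless $G=K_1\vee(K_{n-2}\cup K_1)$. Here $\rho_{\alpha}(K_1\vee(K_{n-2}\cup K_1))$ equals the largest root of $$x^{3}-((\alpha+1)n+\alpha-3)x^{2}+(\alpha n^{2}+(\alpha^{2}-\alpha-1)n-2\alpha+1)x-\alpha^{2}n^{2}+(3\alpha^{2}-\alpha+1)n-4\alpha^{2}+5\alpha-3=0.$$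
   Context: All graphs are finite, simple and undirected. For a graph $G$ with adjacency matrix $A(G)$ and diagonal degree matrix $D(G)$, and $\alpha\in[0,1]$, the $A_{\alpha}$-matrix is $A_{\alpha}(G)=\alpha D(G)+(1-\alpha)A(G)$, and $\rho_{\alpha}(G)$ denotes its largest eigenvalue (the $A_{\alpha}$-spectral radius). For a real $t\geq 0$, $G$ is $t$-tough if $|S|\geq t\,c(G-S)$ for every $S\subseteq V(G)$ with $c(G-S)\geq 2$, where $c(G-S)$ is the number of connected components of $G-S$. $K_m$ is the complete graph on $m$ vertices; $G_1\cup G_2$ is the disjoint union and $G_1\vee G_2$ the join (disjoint union plus all edges between $V(G_1)$ and $V(G_2)$). *)

(* Defs.v *)
From HB Require Import structures.
From mathcomp Require Import all_boot all_order all_algebra.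
From mathcomp Require Import boolp classical_sets reals.
From mathcomp Require Import complex polyrcf.

Set Implicit Arguments.
Unset Strict Implicit.
Unset Printing Implicit Defensive.

Import Order.TTheory GRing.Theory Num.Theory.
Local Open Scope ring_scope.

Record sgraph := SGraph {
  vertex :> finType;
  edge : rel vertex;
  edge_sym : symmetric edge;
  edge_irr : irreflexive edge }.

Definition iso (G H : sgraph) : Prop :=
  exists f : G -> H, bijective f /\ forall x y, edge (f x) (f y) = edge x y.

Section Constructions.
Variables G H : sgraph.

Definition union_edge : rel (G + H)%type := fun u v =>
  match u, v with
  | inl x, inl y => edge x y
  | inr x, inr y => edge x y
  | _, _ => false
  end.

Lemma union_edge_sym : symmetric union_edge.
Proof. by move=> [x|x] [y|y] //=; apply: edge_sym. Qed.

Lemma union_edge_irr : irreflexive union_edge.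
Proof. by move=> [x|x] /=; apply: edge_irr. Qed.

Definition union : sgraph := SGraph union_edge_sym union_edge_irr.

Definition join_edge : rel (G + H)%type := fun u v =>
  match u, v with
  | inl x, inl y => edge x y
  | inr x, inr y => edge x y
  | _, _ => true
  end.

Lemma join_edge_sym : symmetric join_edge.
Proof. by move=> [x|x] [y|y] //=; apply: edge_sym. Qed.

Lemma join_edge_irr : irreflexive join_edge.
Proof. by move=> [x|x] /=; apply: edge_irr. Qed.

Definition join : sgraph := SGraph join_edge_sym join_edge_irr.

End Constructions.

Section Complete.
Variable m : nat.

Definition complete_edge : rel 'I_m := fun x y => x != y.

Lemma complete_edge_sym : symmetric complete_edge.
Proof. by move=> x y; rewrite /complete_edge eq_sym. Qed.

Lemma complete_edge_irr : irreflexive complete_edge.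
Proof. by move=> x; rewrite /complete_edge eqxx. Qed.

Definition complete : sgraph := SGraph complete_edge_sym complete_edge_irr.

End Complete.

Section Deletion.
Variables (G : sgraph) (S : {set G}).

Definition del_edge : rel {x : G | x \notin S} :=
  fun x y => edge (val x) (val y).

Lemma del_edge_sym : symmetric del_edge.
Proof. by move=> x y; apply: edge_sym. Qed.

Lemma del_edge_irr : irreflexive del_edge.
Proof. by move=> x; apply: edge_irr. Qed.

Definition del : sgraph := SGraph del_edge_sym del_edge_irr.

End Deletion.

Definition components (G : sgraph) : nat := n_comp (@edge G) G.

Definition connected (G : sgraph) : Prop := components G = 1%N.

Definition tough (R : realType) (t : R) (G : sgraph) : Prop :=
  forall S : {set G}, (2 <= components (del S))%N ->
    t * (components (del S))%:R <= #|S|%:R.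

Section Spectral.
Variables (R : realType) (alpha : R) (G : sgraph).

Definition degree (x : G) : nat := #|[set y | edge x y]|.

(* Matrices are indexed by 'I_#|G|; vertices are numbered by enum_val. *)
Definition adj_mx : 'M[R]_#|G| :=
  \matrix_(i, j) (edge (enum_val i) (enum_val j))%:R.

Definition deg_mx : 'M[R]_#|G| :=
  diag_mx (\row_i (degree (enum_val i))%:R).

Definition A_alpha : 'M[R]_#|G| := alpha *: deg_mx + (1 - alpha) *: adj_mx.

(* By rho_alphaP below, this supremum is the largest eigenvalue. *)
Definition rho_alpha : R := sup [set x : R | eigenvalue A_alpha x]%classic.

End Spectral.

Lemma A_alpha_sym (R : realType) (alpha : R) (G : sgraph) :
  (A_alpha alpha G)^T = A_alpha alpha G.
Proof.
rewrite /A_alpha linearD !linearZ /= tr_diag_mx; congr (_ + _ *: _).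
by apply/matrixP => i j; rewrite !mxE edge_sym.
Qed.

Lemma A_alpha_eigenvalue (R : realType) (alpha : R) (G : sgraph) :
  (0 < #|G|)%N -> exists x, eigenvalue (A_alpha alpha G) x.
Proof.
move=> n0; set A := A_alpha alpha G.
pose B : 'M[R[i]]_#|G| := map_mx (real_complex R) A.
have Bh : B \is hermsymmx.
  apply/is_hermitianmxP; rewrite expr0 scale1r; apply/matrixP => i j.
  rewrite [RHS]mxE [X in _ = _ X]mxE /B [X in _ = _ X]mxE [LHS]mxE.
  have -> : A j i = A i j.
    by rewrite -[in RHS](A_alpha_sym alpha G : A^T = A) [RHS]mxE.
  by apply/esym/CrealP/complex_realP; exists (A i j).
have dr := hermitian_spectral_diag_real Bh.
have /orthomx_spectralP := hermitian_normalmx Bh.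
move: dr; set P := spectralmx B; set d := spectral_diag B => dr BE.
have Pu : P \in unitmx := spectral_unit B.
pose i0 : 'I_#|G| := Ordinal n0.
have /complex_realP [x dx] : d 0 i0 \is Num.real by apply: (mxOverP dr).
exists x; rewrite -(eigenvalue_map (real_complex R)) -/B.
apply/eigenvalueP; exists (row i0 P).
  rewrite {1}BE -row_mul !mulmxA mulmxV // mul1mx row_mul row_diag_mx.
  by rewrite dx -scalemxAl -rowE.
apply/negP => /eqP r0.
have := congr1 (row i0) (mulmxV Pu); rewrite row_mul r0 mul0mx.
move=> /rowP /(_ i0); rewrite !mxE eqxx => /eqP.
by rewrite eq_sym oner_eq0.
Qed.

Lemma rho_alphaP (R : realType) (alpha : R) (G : sgraph) : (0 < #|G|)%N ->
  eigenvalue (A_alpha alpha G) (rho_alpha alpha G) /\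
  forall y, eigenvalue (A_alpha alpha G) y -> y <= rho_alpha alpha G.
Proof.
move=> n0; set A := A_alpha alpha G.
have [x0 Ax0] : exists x, eigenvalue A x by exact: A_alpha_eigenvalue.
have p0 : char_poly A != 0 by rewrite monic_neq0 ?char_poly_monic.
pose s := rootsR (char_poly A).
have sE y : (y \in s) = eigenvalue A y.
  by rewrite eigenvalue_root_char -roots_on_rootsR.
pose m := \big[Num.max/x0]_(y <- s) y.
have Am : eigenvalue A m.
  rewrite /m big_seq; elim/big_ind : _ => //.
  - by move=> a b Aa Ab; case: (leP a b).
  - by move=> y; rewrite sE.
have ubm y : eigenvalue A y -> y <= m.
  by rewrite -sE => ys; apply: le_bigmax_seq ys _ => //.
suff -> : rho_alpha alpha G = m by [].
apply/eqP; rewrite eq_le; apply/andP; split.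
  by apply: ge_sup => [|y /= /ubm //]; exists x0.
by apply: ub_le_sup => //; exists m => y /= /ubm.
Qed.

Definition largest_root (R : realType) (p : {poly R}) (x : R) : Prop :=
  root p x /\ forall y, root p y -> y <= x.

Definition f (R : realType) (alpha : R) : R :=
  if alpha <= 2%:R / 3%:R then 6%:R else 4%:R / (1 - alpha).

(* K_1 v (K_(n-2) u K_1); n - 2 is truncated, so this has order n only if
   2 <= n. *)
Definition extremal (n : nat) : sgraph :=
  join (complete 1) (union (complete (n - 2)) (complete 1)).

Definition cubic (R : realType) (alpha : R) (n : nat) : {poly R} :=
  let N : R := n%:R in
  'X^3 - ((alpha + 1) * N + alpha - 3) *: 'X^2
  + (alpha * N ^+ 2 + (alpha ^+ 2 - alpha - 1) * N - 2 * alpha + 1) *: 'X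
  + (- alpha ^+ 2 * N ^+ 2 + (3 * alpha ^+ 2 - alpha + 1) * N
     - 4 * alpha ^+ 2 + 5 * alpha - 3)%:P.

(* Main.v *)
(* Write b = 1 - alpha and let S violate 1-toughness: |S| = s and G - S has at
   least s + 1 components.  An upper bound on rho_alpha(G) needs only a positive
   vector X with A_alpha X <= c X; take X = 1 on S and
   X = b s / (c - alpha s + 1 - m) on a component with m vertices, which is an
   eigenvector off S when G is the join of a clique on S with a union of cliques.
   The condition on S is worst, by convexity in m, when all components but one
   are singletons, and then it is a scalar inequality in s, n, c.
   - For s = 0 every degree, hence rho_alpha(G), is at most n - 2, which is less
     than rho_alpha of the extremal graph.
   - For s >= 2 it holds with c = n - 2, except for (s, n) = (2, 6), (3, 7) and
     1/3 <= b < 2/5, where c = n - 2 + 1/10, still less than rho_alpha of the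
     extremal graph, works.
   - For s = 1 it holds, with equality, for c = rho_alpha of the extremal graph,
     and equality throughout forces G to be the extremal graph. *)
Require Import Defs.
From mathcomp Require Import all_boot all_order all_algebra.
From mathcomp Require Import all_fingroup.
From mathcomp Require Import reals polyrcf.
From mathcomp Require Import ring lra zify.
Import Order.TTheory GRing.Theory Num.Theory.
Local Open Scope ring_scope.

(** * Test vectors for the spectral radius *)

(** [A_alpha] acting on functions on vertices, free of the numbering by ordinals. *)
Definition Aop {R : realType} (a : R) {G : sgraph} (w : G -> R) (x : G) : R :=
  a * (degree x)%:R * w x + (1 - a) * \sum_(y | edge x y) w y.

Lemma mulmx_A_alpha {R : realType} (a : R) (G : sgraph) (w : G -> R) :
  (\row_i w (enum_val i)) *m A_alpha a G = \row_i Aop a w (enum_val i).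
Proof.
apply/rowP => j; rewrite !mxE.
under eq_bigr do rewrite !mxE mulrDr.
rewrite big_split /=; congr (_ + _).
  rewrite (bigD1 j) //= eqxx mulr1n big1 ?addr0 => [|i /negPf ij].
    by rewrite mulrC.
  by rewrite ij mulr0n !mulr0.
rewrite mulr_sumr [RHS]big_mkcond /= (reindex _ (onW_bij _ (@enum_val_bij G))) /=.
apply: eq_bigr => i _; rewrite edge_sym; case: ifP => _.
  by rewrite mulr1 mulrC.
by rewrite !mulr0.
Qed.

Lemma eigenvalue_Aop {R : realType} (a c : R) (G : sgraph) :
  eigenvalue (A_alpha a G) c <->
  exists w : G -> R, (exists x, w x != 0) /\ forall x, Aop a w x = c * w x.
Proof.
split.
  move=> /eigenvalueP[v vA v0]; exists (fun x => v 0 (enum_rank x)).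
  have vE : v = \row_i v 0 (enum_rank (enum_val i)).
    by apply/rowP => i; rewrite mxE enum_valK.
  split.
    have /rV0Pn[i vi] := v0; exists (enum_val i); by rewrite enum_valK.
  move=> x; have := mulmx_A_alpha a G (fun x => v 0 (enum_rank x)).
  by rewrite -vE vA => /rowP /(_ (enum_rank x)); rewrite !mxE !enum_rankK => <-.
move=> [w [[x wx] wA]]; apply/eigenvalueP; exists (\row_i w (enum_val i)).
  by rewrite mulmx_A_alpha; apply/rowP => i; rewrite !mxE wA.
apply/negP => /eqP /rowP /(_ (enum_rank x)); rewrite !mxE enum_rankK => /eqP.
by rewrite (negPf wx).
Qed.

(** Self-adjointness moves the operator from an eigenvector to a test vector. *)
Lemma Aop_sym {R : realType} (a : R) (G : sgraph) (u w : G -> R) :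
  \sum_x u x * Aop a w x = \sum_x w x * Aop a u x.
Proof.
have split_sum (f g : G -> R) : \sum_x f x * Aop a g x =
    \sum_x a * (degree x)%:R * (f x * g x)
    + (1 - a) * \sum_x \sum_(y | edge x y) f x * g y.
  rewrite mulr_sumr -big_split; apply: eq_bigr => x _ /=.
  rewrite mulrDr; congr (_ + _); first by rewrite mulrCA.
  by rewrite mulrCA mulr_sumr.
rewrite !split_sum; congr (_ + _ * _).
  by apply: eq_bigr => x _; rewrite [u x * _]mulrC.
rewrite (exchange_big_dep predT) //=; apply: eq_bigr => x _.
by apply: eq_big => [y|y _]; [rewrite edge_sym|rewrite mulrC].
Qed.

Lemma norm_Aop_le {R : realType} (a : R) (G : sgraph) (w : G -> R) (x : G) :
  0 <= a < 1 -> `|Aop a w x| <= Aop a (fun y => `|w y|) x.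
Proof.
move=> /andP[a0 a1]; have b0 : 0 <= 1 - a by rewrite subr_ge0 ltW.
apply: le_trans (ler_normD _ _) _.
rewrite !normrM (ger0_norm a0) (ger0_norm b0) normr_nat.
by rewrite lerD2l ler_wpM2l // ler_norm_sum.
Qed.

(* Pair [X] with the absolute value of an eigenvector for [y]. *)
Lemma eigenvalue_le {R : realType} (a c y : R) (G : sgraph) (X : G -> R) :
  0 <= a < 1 -> (forall x, 0 < X x) -> (forall x, Aop a X x <= c * X x) ->
  eigenvalue (A_alpha a G) y -> y <= c.
Proof.
move=> a01 X0 Xc /eigenvalue_Aop[w [[x0 wx0] wy]].
have S0 : 0 < \sum_x X x * `|w x|.
  rewrite (bigD1 x0) //= ltr_wpDr ?sumr_ge0 // => [x _|].
    by rewrite mulr_ge0 // ltW.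
  by rewrite mulr_gt0 ?normr_gt0.
apply: le_trans (ler_norm y) _.
rewrite -(ler_pM2r S0) !mulr_sumr.
apply: (@le_trans _ _ (\sum_x X x * Aop a (fun x => `|w x|) x)).
  apply: ler_sum => x _; rewrite mulrCA -normrM -wy.
  by rewrite ler_wpM2l ?norm_Aop_le // ltW.
rewrite Aop_sym; apply: ler_sum => x _.
by rewrite [X x * _]mulrC mulrCA ler_wpM2l.
Qed.

Lemma connected_connect (G : sgraph) :
  connected G -> forall x y : G, connect (@edge G) x y.
Proof.
move=> cG x y; have es := sym_connect_sym (@edge_sym G).
apply/(fingraph.rootP es).
have /eqP /cards1P[z zE] : #|[set x in fingraph.roots (@edge G)]| = 1%N.
  rewrite cardsE -[RHS]cG /components /n_comp_mem.
  by apply: eq_card => u; rewrite !inE andbT.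
have rz u : fingraph.root (@edge G) u = z.
  by apply/set1P; rewrite -zE inE; apply: roots_root.
by rewrite !rz.
Qed.

(** The equality case of [eigenvalue_le]. For [u] the absolute value of an eigenvector, pairing with
    [X] turns every inequality into an equality, so [u] is an eigenvector as well. By connectedness
    it vanishes nowhere and cancels from [u x * Aop a X x = u x * (c * X x)]. *)
Lemma eigenvalue_eq {R : realType} (a c : R) (G : sgraph) (X : G -> R) :
  0 <= a < 1 -> connected G ->
  (forall x, 0 < X x) -> (forall x, Aop a X x <= c * X x) ->
  eigenvalue (A_alpha a G) c -> forall x, Aop a X x = c * X x.
Proof.
move=> a01 cG X0 Xc /eigenvalue_Aop[w [[x0 wx0] wy]].
have /andP[a0 a1] := a01.
pose u x := `|w x|.
have u0 x : 0 <= u x := normr_ge0 _.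
have uA x : c * u x <= Aop a u x.
  apply: le_trans (norm_Aop_le a G w x a01); rewrite wy normrM.
  by rewrite ler_wpM2r // ler_norm.
have uX x : u x * Aop a X x <= u x * (c * X x) by rewrite ler_wpM2l.
have Xu x : X x * (c * u x) <= X x * Aop a u x by rewrite ler_wpM2l // ltW.
have EX : \sum_x X x * (c * u x) = \sum_x u x * (c * X x).
  by apply: eq_bigr => x _; ring.
have le1 : \sum_x X x * (c * u x) <= \sum_x X x * Aop a u x by apply: ler_sum.
have le2 : \sum_x u x * Aop a X x <= \sum_x u x * (c * X x) by apply: ler_sum.
have sumeq (F F' : G -> R) : (forall x, F x <= F' x) ->
    \sum_x F' x <= \sum_x F x -> forall x, F x = F' x.
  move=> FF' le x; apply/eqP; rewrite eq_sym -subr_eq0; apply/eqP.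
  apply: (psumr_eq0P (P := predT) (F := fun x => F' x - F x)) => //.
    by move=> z _; rewrite subr_ge0.
  by apply/eqP; rewrite sumrB subr_eq0 eq_le le ler_sum.
have uAE x : Aop a u x = c * u x.
  apply: (mulfI (lt0r_neq0 (X0 x))); apply/esym.
  by apply: (sumeq (fun x => X x * (c * u x)) (fun x => X x * Aop a u x)) => //;
    rewrite EX Aop_sym.
have uXE x : u x * Aop a X x = u x * (c * X x).
  by apply: (sumeq (fun x => u x * Aop a X x) (fun x => u x * (c * X x))) => //;
    rewrite -EX -Aop_sym.
(* At a zero of [u] the eigenvalue equation says that a sum of nonnegative terms over the neighbours
   is zero. *)
have step x y : edge x y -> u x = 0 -> u y = 0.
  move=> xy ux; have := uAE x; rewrite /Aop ux !mulr0 add0r => /eqP.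
  rewrite mulf_eq0 subr_eq0 eq_sym lt_eqF //= => /eqP /psumr_eq0P; exact.
have upos x : u x != 0.
  apply/negP => /eqP ux; move: wx0; rewrite -normr_eq0 => /negP; apply; apply/eqP.
  have /connectP[p] := connected_connect G cG x x0.
  elim: p x ux => [|y p IH] x ux /=; first by move=> _ ->.
  by move=> /andP[/step /(_ ux) uy py]; apply: IH.
move=> x; exact: (mulfI (upos x)).
Qed.

Lemma rho_alpha_le {R : realType} (a c : R) (G : sgraph) (X : G -> R) :
  0 <= a < 1 -> (0 < #|G|)%N -> (forall x, 0 < X x) ->
  (forall x, Aop a X x <= c * X x) -> rho_alpha a G <= c.
Proof.
move=> a01 G0 X0 Xc; have [rE _] := rho_alphaP a G0.
exact: eigenvalue_le rE.
Qed.

Lemma rho_alpha_eq {R : realType} (a c : R) (G : sgraph) (X : G -> R) :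
  0 <= a < 1 -> (0 < #|G|)%N -> (forall x, 0 < X x) ->
  (forall x, Aop a X x = c * X x) -> rho_alpha a G = c.
Proof.
move=> a01 G0 X0 Xc; apply/eqP; rewrite eq_le (rho_alpha_le _ _ _ X) //=; last first.
  by move=> x; rewrite Xc.
have [_ ub] := rho_alphaP a G0; apply/ub/eigenvalue_Aop.
exists X; split=> //; have /card_gt0P[x _] := G0.
by exists x; rewrite gt_eqF.
Qed.

(** * The extremal graph *)

Lemma natr_degree (R : realType) (G : sgraph) (x : G) :
  (degree x)%:R = \sum_(y | edge x y) 1 :> R.
Proof. by rewrite /degree cardsE sumr_const. Qed.

(** The right side is the characteristic polynomial of the quotient matrix for the equitable
    partition into hub, clique and pendant vertex. *)
Lemma cubicE {R : realType} (a x : R) (n : nat) :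
  (cubic a n).[x] = (x - a * (n%:R - 1)) * (x - (n%:R - 3 + a)) * (x - a)
    - (1 - a) ^+ 2 * (n%:R - 2) * (x - a) - (1 - a) ^+ 2 * (x - (n%:R - 3 + a)).
Proof. rewrite /cubic !(hornerD, hornerN, hornerZ, hornerXn, hornerX, hornerC); ring. Qed.

Lemma card_extremal (n : nat) : (2 <= n)%N -> #|extremal n| = n.
Proof. by move=> n2; rewrite !card_sum !card_ord; lia. Qed.

Lemma sum_extremal {R : realType} (n : nat) (P : pred (extremal n))
    (F : extremal n -> R) :
  \sum_(u | P u) F u = \sum_(i : 'I_1 | P (inl i)) F (inl i)
    + (\sum_(i : 'I_(n - 2) | P (inr (inl i))) F (inr (inl i))
       + \sum_(i : 'I_1 | P (inr (inr i))) F (inr (inr i))).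
Proof.
rewrite (big_sumType _ P F); congr (_ + _).
exact: (big_sumType _ (fun u => P (inr u)) (fun u => F (inr u))).
Qed.

Definition by_class {R : realType} (n : nat) (p y z : R) (u : extremal n) : R :=
  match u with inl _ => p | inr (inl _) => y | inr (inr _) => z end.

Lemma sum_edge_extremal {R : realType} (n : nat) (p y z : R) (v : extremal n) :
  \sum_(u | edge v u) by_class n p y z u
  = by_class n ((n - 2)%:R * y + z) (p + (n - 2).-1%:R * y) p v.
Proof.
have sumneq (c : R) (k : nat) (i : 'I_k) : \sum_(j < k | i != j) c = c *+ k.-1.
  rewrite sumr_const; congr (_ *+ _); rewrite -[in RHS](card_ord k) -(cardC1 i).
  by apply: eq_card => j; rewrite !inE eq_sym.
rewrite sum_extremal /extremal; case: v => [i|[i|i]] /=; rewrite ?sumneq.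
- by rewrite mulr0n add0r !sumr_const !card_ord mulr1n mulr_natl.
- by rewrite big_pred0_eq addr0 sumr_const card_ord mulr1n mulr_natl.
- by rewrite big_pred0_eq add0r mulr0n addr0 sumr_const card_ord mulr1n.
Qed.

(** With value 1 on the hub, the equations at the clique and at the pendant vertex determine [y] and
    [z], positive because [x] exceeds [n - 2]; the equation at the hub is then the cubic. In
    particular at most one root exceeds [n - 2]. *)
Lemma rho_extremal {R : realType} (a x : R) (n : nat) :
  0 <= a < 1 -> (3 <= n)%N -> n%:R - 2 < x -> root (cubic a n) x ->
  rho_alpha a (extremal n) = x.
Proof.
move=> /andP[a0 a1] n3 nx /rootP; rewrite cubicE => px.
have nR : (3 : R) <= n%:R by rewrite ler_nat.
have P0 : 0 < x - (n%:R - 3 + a) by lra.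
have Q0 : 0 < x - a by lra.
have b0 : 0 < 1 - a by lra.
pose y := (1 - a) / (x - (n%:R - 3 + a)); pose z := (1 - a) / (x - a).
have yE : y * (x - (n%:R - 3 + a)) = 1 - a by rewrite divfK ?gt_eqF.
have zE : z * (x - a) = 1 - a by rewrite divfK ?gt_eqF.
have cE : x = a * (n%:R - 1) + (1 - a) * ((n%:R - 2) * y + z).
  apply: (mulIf (lt0r_neq0 P0)); apply: (mulIf (lt0r_neq0 Q0)).
  transitivity (a * (n%:R - 1) * (x - (n%:R - 3 + a)) * (x - a)
    + (1 - a) * ((n%:R - 2) * (y * (x - (n%:R - 3 + a))) * (x - a)
                 + z * (x - a) * (x - (n%:R - 3 + a)))); last by ring.
  rewrite yE zE; apply/eqP; rewrite -subr_eq0 -px; apply/eqP; ring.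
pose X := by_class n 1 y z.
have m1 : ((n - 2)%:R : R) = n%:R - 2 by rewrite natrB //; lia.
have m2 : ((n - 2).-1%:R : R) = n%:R - 3 by rewrite -subn1 -subnDA natrB.
apply: (@rho_alpha_eq _ a x _ X).
- by rewrite a0.
- by rewrite card_extremal //; lia.
- by move=> [_|[_|_]] /=; rewrite ?ltr01 ?divr_gt0.
move=> u; rewrite /Aop natr_degree.
have -> : \sum_(w | edge u w) (1 : R) = by_class n (n%:R - 1) (n%:R - 2) 1 u.
  transitivity (\sum_(w | edge u w) by_class n (1 : R) 1 1 w).
    by apply: eq_bigr => -[?|[?|?]].
  by rewrite sum_edge_extremal m1 m2; case: u => [_|[_|_]] /=; ring.
rewrite sum_edge_extremal m1 m2 /X; case: u => [_|[_|_]] /=.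
- by rewrite !mulr1 -cE.
- transitivity (x * y - (y * (x - (n%:R - 3 + a)) - (1 - a))); first by ring.
  by rewrite yE subrr subr0.
- transitivity (x * z - (z * (x - a) - (1 - a))); first by ring.
  by rewrite zE subrr subr0.
Qed.
(** * Scalar inequalities *)

(* The numerator of [n - 2 - cut_bound a s n (n - 2)], see [cut_bound_le], for
   [b = 1 - a] and [u = n - s]. *)
Definition quad_form {R : realType} (b s u : R) : R :=
  b ^+ 2 * s * (2 * u * s - u - 2 * s - s ^+ 2)
  + b * ((s - 1) * (u ^+ 2 - 2 * u - s) - s * (u - 2)) - (s - 1) * (u - 2).

(* Multiply by [(s + u) ^+ 2] and expand in [b * (s + u) - 4], [s - 2] and
   [u - s - 1]: only a constant term is negative. *)
Lemma quad_form_ge0_of_mul {R : realType} (b s u : R) :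
  2 <= s -> s + 1 <= u -> 6 <= s + u -> 4 <= b * (s + u) -> 0 <= quad_form b s u.
Proof.
move=> hs hu hn hb.
pose x := s - 2; pose y := u - s - 1; pose z := b * (s + u) - 4.
have x0 : 0 <= x by rewrite /x; lra.
have y0 : 0 <= y by rewrite /y; lra.
have z0 : 0 <= z by rewrite /z; lra.
(* This is [6 <= s + u]; it pays for the negative constants -1 and -13 below. *)
have xy : 1 <= 2 * x + y by rewrite /x /y; lra.
suff : 0 <= (s + u) ^+ 2 * quad_form b s u by rewrite pmulr_rge0 // exprn_gt0 //; lra.
have -> : (s + u) ^+ 2 * quad_form b s u =
  (z ^+ 2 + 8 * z) * (s * (2 * u * s - u - 2 * s - s ^+ 2))
  + z * (s + u) * ((s - 1) * (u ^+ 2 - 2 * u - s) - s * (u - 2))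
  + (16 * s * (2 * u * s - u - 2 * s - s ^+ 2)
   + 4 * (s + u) * ((s - 1) * (u ^+ 2 - 2 * u - s) - s * (u - 2))
   - (s + u) ^+ 2 * ((s - 1) * (u - 2))).
  rewrite /quad_form /z; ring.
have es : s = x + 2 by rewrite /x; ring.
have eu : u = x + y + 3 by rewrite /x /y; ring.
have m0 i j : 0 <= x ^+ i * y ^+ j by rewrite mulr_ge0 ?exprn_ge0.
have x20 : 0 <= x ^+ 2 by rewrite exprn_ge0.
have y20 : 0 <= y ^+ 2 by rewrite exprn_ge0.
have xy0 : 0 <= x * y by rewrite mulr_ge0.
apply: addr_ge0; [apply: addr_ge0|].
- apply: mulr_ge0; first by rewrite addr_ge0 ?exprn_ge0 ?mulr_ge0.
  apply: mulr_ge0; first by lra.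
  rewrite es eu.
  have -> : 2 * (x + y + 3) * (x + 2) - (x + y + 3) - 2 * (x + 2) - (x + 2) ^+ 2
    = x ^+ 2 + 2 * (x * y) + 3 * x + 3 * y + 1 by ring.
  lra.
- apply: mulr_ge0; first by apply: mulr_ge0; lra.
  rewrite es eu.
  have -> : (x + 2 - 1) * ((x + y + 3) ^+ 2 - 2 * (x + y + 3) - (x + 2))
     - (x + 2) * (x + y + 3 - 2)
    = x ^+ 3 + 2 * (x ^+ 2 * y) + 3 * x ^+ 2 + x * y ^+ 2 + 5 * (x * y) + y ^+ 2
      + (x + 2 * y - 1) by ring.
  have q : 0 <= 3 * x ^+ 2 + 5 * (x * y) + y ^+ 2 + (x + 2 * y - 1).
    have : 0 <= (x - 1 / 2) ^+ 2 by rewrite sqr_ge0.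
    rewrite sqrrB; lra.
  have := m0 2 1; have := m0 1 2; have := m0 3 0; rewrite !expr0 !expr1 ?mulr1.
  lra.
- rewrite es eu.
  set e := (X in 0 <= X).
  have -> : e = -13 + 97 * y + 17 * y ^+ 2 + 3 * y ^+ 3 + 54 * x + 163 * (x * y)
     + 32 * (x * y ^+ 2) + 3 * (x * y ^+ 3) + 79 * x ^+ 2 + 82 * (x ^+ 2 * y)
     + 11 * (x ^+ 2 * y ^+ 2) + 32 * x ^+ 3 + 12 * (x ^+ 3 * y) + 4 * x ^+ 4.
    rewrite /e; ring.
  have := m0 2 1; have := m0 1 2; have := m0 3 0; have := m0 1 3; have := m0 2 2.
  have := m0 3 1; have := m0 4 0; have := m0 0 3.
  rewrite !expr0 !expr1 ?mulr1 ?mul1r; lra.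
Qed.

(** If [1 / 3 <= b] and [12 <= n] then [4 <= b * n], so finitely many pairs remain. In the two
    exceptional ones the form is negative at [b = 1 / 3]; the threshold 2/5 is its root for [n = 7],
    [s = 3]. *)
Lemma quad_form_ge0 {R : realType} (b : R) (n s : nat) :
  1 / 3 <= b \/ 4 <= b * n%:R -> (6 <= n)%N -> (2 <= s)%N -> (s + s < n)%N ->
  [/\ n = 6%N, s = 2%N & b < 2 / 5] \/ [/\ n = 7%N, s = 3%N & b < 2 / 5] \/
  0 <= quad_form b s%:R (n%:R - s%:R).
Proof.
move=> hb n6 s2 sn.
have mulcase : 4 <= b * n%:R -> 0 <= quad_form b s%:R (n%:R - s%:R).
  move=> h; have su : s%:R + (n%:R - s%:R) = n%:R :> R by rewrite addrC subrK.
  apply: quad_form_ge0_of_mul; rewrite ?su ?ler_nat //.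
  by rewrite lerBrDr natr1 -natrD ler_nat addSn.
case: hb => [hb|/mulcase]; last by right; right.
have [n12|n12] := leqP 12 n.
  right; right; apply: mulcase.
  have : (12 : R) <= n%:R by rewrite ler_nat.
  nra.
clear mulcase.
(* With nonnegative coefficients the form increases with [b], so it suffices to test the lower end
   [b0] of the range. *)
have aux (b0 A B C : R) : 0 <= b0 -> b0 <= b -> 0 <= A -> 0 <= B ->
    C <= b0 ^+ 2 * A + b0 * B -> 0 <= b ^+ 2 * A + b * B - C.
  move=> b00 b0b A0 B0 h; rewrite subr_ge0; apply: le_trans h _.
  by rewrite lerD ?ler_wpM2r ?lerXn2r ?nnegrE // (le_trans b00).
have [en|[en|[en|[en|[en|en]]]]] : n = 6%N \/ n = 7%N \/ n = 8%N \/ n = 9%N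
    \/ n = 10%N \/ n = 11%N by lia.
all: have [es|[es|[es|es]]] : s = 2%N \/ s = 3%N \/ s = 4%N \/ s = 5%N by lia.
all: try by rewrite en es in sn.
all: have [b1|b1] := ltrP b (2 / 5); try by left.
all: right; try by left.
all: right; rewrite /quad_form -(mulrA (b ^+ 2)) en es.
all: try by apply: (aux (1 / 3)); lra.
all: by apply: (aux (2 / 5)); lra.
Qed.

(** The cubic is positive at [n - 1], hence has a root beyond [c], which [rho_extremal]
    identifies. *)
Lemma rho_extremal_gt {R : realType} (a c : R) (n : nat) :
  0 <= a < 1 -> (3 <= n)%N -> n%:R - 2 <= c -> c <= n%:R - 1 ->
  (cubic a n).[c] < 0 ->
  c < rho_alpha a (extremal n) /\ root (cubic a n) (rho_alpha a (extremal n)).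
Proof.
move=> a01 n3 c1 c2 pc; have /andP[a0 a1] := a01.
have nR : (3 : R) <= n%:R by rewrite ler_nat.
have b0 : 0 < 1 - a by lra.
have p1 : 0 < (cubic a n).[n%:R - 1].
  have -> : (cubic a n).[n%:R - 1] =
    (1 - a) * ((n%:R - 1) * (n%:R - 1 - a)) + (1 - a) ^+ 2 * (n%:R - 3).
    rewrite cubicE; ring.
  apply: ltr_pwDl; first by rewrite !mulr_gt0 //; lra.
  by rewrite mulr_ge0 ?sqr_ge0 //; lra.
have pp : (cubic a n).[c] * (cubic a n).[n%:R - 1] < 0 by rewrite nmulr_rlt0.
have [x] := poly_ivtoo c2 pp; rewrite in_itv /= => /andP[cx _] rx.
by rewrite (rho_extremal a x n) //; apply: le_lt_trans cx.
Qed.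

Lemma cubic_lt0 {R : realType} (a : R) (n : nat) :
  0 <= a < 1 -> (3 <= n)%N -> (cubic a n).[n%:R - 2] < 0.
Proof.
move=> /andP[a0 a1] n3; have nR : (3 : R) <= n%:R by rewrite ler_nat.
have -> : (cubic a n).[n%:R - 2] =
  - ((n%:R - 2 - a) * a * (1 - a) + (1 - a) ^+ 3) by rewrite cubicE; ring.
rewrite oppr_lt0 ltr_wpDl ?exprn_gt0 ?subr_gt0 // !mulr_ge0 //; lra.
Qed.

(* The value forced on a cut vertex by the test vector [cut_vector] below when
   the target eigenvalue is [c] and [G - S] consists of [s] isolated vertices
   and a clique on [n - 2s] vertices. *)
Definition cut_bound {R : realType} (a s n c : R) : R :=
  a * (n - 1) + (1 - a) * (s - 1)
  + (1 - a) * (s * ((1 - a) * s / (c - a * s))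
      + (n - 2 * s) * ((1 - a) * s / (c - a * s + 1 - (n - 2 * s)))).

(** For [s = 1] the configuration behind [cut_bound] is the extremal graph, so clearing denominators
    gives the cubic. *)
Lemma cut_bound_root {R : realType} (a x : R) (n : nat) :
  0 <= a < 1 -> (3 <= n)%N -> n%:R - 2 < x -> root (cubic a n) x ->
  cut_bound a 1 n%:R x = x.
Proof.
move=> /andP[a0 a1] n3 nx /rootP; rewrite cubicE => px.
have nR : (3 : R) <= n%:R by rewrite ler_nat.
apply/eqP; rewrite -subr_eq0 /cut_bound; apply/eqP.
have P0 : x - a != 0 by rewrite gt_eqF //; lra.
have Q0 : x - a + 1 - (n%:R - 2) != 0 by rewrite gt_eqF //; lra.
rewrite !mulr1.
transitivity (- ((x - a * (n%:R - 1)) * (x - (n%:R - 3 + a)) * (x - a)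
    - (1 - a) ^+ 2 * (n%:R - 2) * (x - a) - (1 - a) ^+ 2 * (x - (n%:R - 3 + a)))
   / ((x - a) * (x - a + 1 - (n%:R - 2)))).
  by field; rewrite P0 Q0.
by rewrite px oppr0 mul0r.
Qed.

Lemma cut_bound_le {R : realType} (a s n : R) :
  0 <= a < 1 -> 2 <= s -> 2 * s + 1 <= n -> 0 <= quad_form (1 - a) s (n - s) ->
  cut_bound a s n (n - 2) <= n - 2.
Proof.
move=> /andP[a0 a1] s2 sn q0.
have as0 : a * s <= s by rewrite ler_piMl //; lra.
have P0 : 0 < n - 2 - a * s by lra.
have Q0 : 0 < n - 2 - a * s + 1 - (n - 2 * s) by lra.
rewrite -subr_ge0.
have -> : n - 2 - cut_bound a s n (n - 2) = quad_form (1 - a) s (n - s)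
    / ((n - 2 - a * s) * (n - 2 - a * s + 1 - (n - 2 * s))).
  by rewrite /cut_bound /quad_form; field; rewrite !gt_eqF.
by rewrite divr_ge0 // ltW // mulr_gt0.
Qed.

Lemma cut_bound_2_6 {R : realType} (a : R) : 1 / 3 <= 1 - a -> 1 - a < 2 / 5 ->
  cut_bound a 2 6 (6 - 2 + 1 / 10) <= 6 - 2 + 1 / 10.
Proof.
move=> b1 b2; rewrite -subr_ge0 /cut_bound.
have P0 : 0 < 6 - 2 + 1 / 10 - a * 2 by lra.
have Q0 : 0 < 6 - 2 + 1 / 10 - a * 2 + 1 - (6 - 2 * 2) by lra.
set e := (X in 0 <= X).
have -> : e = (92 / 10 * (1 - a) ^+ 2 + 348 / 100 * (1 - a) - 2079 / 1000)
  / ((6 - 2 + 1 / 10 - a * 2) * (6 - 2 + 1 / 10 - a * 2 + 1 - (6 - 2 * 2))).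
  by rewrite /e; field; rewrite !gt_eqF //; lra.
apply: divr_ge0; last by rewrite ltW // mulr_gt0.
(* The tangent at 1/3 bounds the square from below and leaves a linear inequality. *)
have : 0 <= (1 - a - 1 / 3) ^+ 2 by rewrite sqr_ge0.
rewrite !expr2; lra.
Qed.

(** Here [n - 2 * s = 1], so the two denominators agree and the numerator is linear; at
    [1 - a = 1 / 3] it is only 1/100. *)
Lemma cut_bound_3_7 {R : realType} (a : R) : 1 / 3 <= 1 - a -> 1 - a < 2 / 5 ->
  cut_bound a 3 7 (7 - 2 + 1 / 10) <= 7 - 2 + 1 / 10.
Proof.
move=> b1 b2; rewrite -subr_ge0 /cut_bound.
have P0 : 0 < 7 - 2 + 1 / 10 - a * 3 by lra.
have Q0 : 0 < 7 - 2 + 1 / 10 - a * 3 + 1 - (7 - 2 * 3) by lra.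
set e := (X in 0 <= X).
have -> : e = (57 / 10 * (1 - a) - 189 / 100) / (7 - 2 + 1 / 10 - a * 3).
  by rewrite /e; field; rewrite !gt_eqF //; lra.
apply: divr_ge0; lra.
Qed.

Lemma cubic_lt0_small {R : realType} (a : R) (n : nat) :
  n = 6%N \/ n = 7%N -> 1 / 3 <= 1 - a -> 1 - a < 2 / 5 ->
  (cubic a n).[n%:R - 2 + 1 / 10] < 0.
Proof.
move=> hn b1 b2; rewrite cubicE.
have nR : n%:R = 6 :> R \/ n%:R = 7 :> R by case: hn => ->; [left|right].
pose b := 1 - a.
have -> : a = 1 - b by rewrite /b; ring.
set e := (X in X < 0).
have -> : e = (n%:R - 3 + 1 / 10 + b)
    * (b ^+ 2 - b + 1 / 10 * n%:R * b - 9 / 100) - b ^+ 2 * (b + 1 / 10).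
  by rewrite /e; field.
have b3 : 1 / 3 <= b by [].
have b4 : b < 2 / 5 by [].
(* On this interval [b ^+ 2] lies below its chord, which makes the quadratic factor in [h1]
   linear. *)
have h : 0 <= (2 / 5 - b) * (b - 1 / 3) by rewrite mulr_ge0 //; lra.
have h1 : (n%:R - 3 + 1 / 10 + b) * (b ^+ 2 - b + 1 / 10 * n%:R * b - 9 / 100) < 0.
  by rewrite expr2 pmulr_rlt0; case: nR => ->; lra.
have h2 : 0 <= b ^+ 2 * (b + 1 / 10) by rewrite mulr_ge0 ?sqr_ge0 //; lra.
lra.
Qed.

Lemma f_le_cases {R : realType} (a : R) (n : nat) :
  0 <= a < 1 -> f a <= n%:R ->
  (6 <= n)%N /\ (1 / 3 <= 1 - a \/ 4 <= (1 - a) * n%:R).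
Proof.
move=> /andP[a0 a1]; have b0 : 0 < 1 - a by lra.
rewrite /f; case: (lerP a (2%:R / 3%:R)) => ha.
  by rewrite ler_nat => ->; split=> //; left; lra.
rewrite ler_pdivrMr // mulrC => h; split; last by right.
rewrite -(ler_nat R).
(* With [4 <= (1 - a) * n] this even gives [12 <= n]. *)
have : (1 - a) * n%:R <= 1 / 3 * n%:R by rewrite ler_wpM2r //; lra.
lra.
Qed.

(** Supplies the target value for cuts with at least two vertices; lying strictly below the extremal
    radius, it contradicts the hypothesis on [rho_alpha]. *)
Lemma extremal_gap {R : realType} (a : R) (n s : nat) :
  0 <= a < 1 -> f a <= n%:R -> (2 <= s)%N -> (s + s < n)%N ->
  exists c : R, [/\ n%:R - 2 <= c, c < rho_alpha a (extremal n)
    & cut_bound a s%:R n%:R c <= c].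
Proof.
move=> a01 fn s2 sn; have /andP[a0 a1] := a01.
have n3 : (3 <= n)%N by lia.
have [hn6 hb] := f_le_cases a n a01 fn.
have at_n2 : 0 <= quad_form (1 - a) s%:R (n%:R - s%:R) -> exists c : R,
    [/\ n%:R - 2 <= c, c < rho_alpha a (extremal n) & cut_bound a s%:R n%:R c <= c].
  move=> q0; exists (n%:R - 2); split=> //.
    apply: (proj1 (rho_extremal_gt a _ n _ _ _ _ _)) => //; first by lra.
    exact: cubic_lt0.
  apply: cut_bound_le => //; first by rewrite ler_nat.
  by rewrite -natrM natr1 ler_nat; lia.
have [[en es b1]|[[en es b1]|/at_n2//]] := quad_form_ge0 (1 - a) n s hb hn6 s2 sn.
all: have b3 : 1 / 3 <= 1 - a by case: hb => //; rewrite en; lra.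
all: exists (n%:R - 2 + 1 / 10); split; first by lra.
- apply: (proj1 (rho_extremal_gt a _ n _ _ _ _ _)) => //; try lra.
  by apply: cubic_lt0_small => //; left.
- by rewrite en es; apply: cut_bound_2_6.
- apply: (proj1 (rho_extremal_gt a _ n _ _ _ _ _)) => //; try lra.
  by apply: cubic_lt0_small => //; right.
- by rewrite en es; apply: cut_bound_3_7.
Qed.

(** * The test vector of a cut *)

Section Cut.

Variables (R : realType) (a : R) (G : sgraph) (S : {set G}).
(* [lab] numbers the components of [G - S]; its labels form the set [Q]. *)
Variables (T : finType) (lab : G -> T) (Q : {set T}).
Hypothesis a01 : 0 <= a < 1.
Hypothesis lab_mem : forall v, v \notin S -> lab v \in Q.
Hypothesis lab_onto : forall t, t \in Q -> exists2 v, v \notin S & lab v = t.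
Hypothesis edge_lab :
  forall u v, u \notin S -> v \notin S -> edge u v -> lab u = lab v.

Definition lab_class (t : T) : {set G} := [set u | (u \notin S) && (lab u == t)].

Definition out_nbrs (v : G) : {set G} := [set u | edge v u && (u \notin S)].

Definition in_nbrs (v : G) : {set G} := [set u | edge v u && (u \in S)].

Definition cut_vector (xi : T -> R) (v : G) : R := if v \in S then 1 else xi (lab v).

Lemma sum_lab (xi : T -> R) :
  \sum_(v | v \notin S) xi (lab v) = \sum_(t in Q) #|lab_class t|%:R * xi t.
Proof.
rewrite (partition_big lab (mem Q)) //=; apply: eq_bigr => t _.
under eq_bigr => v /andP[_ /eqP ->] do [].
rewrite mulr_natl -sumr_const; apply: eq_bigl => v; by rewrite inE.
Qed.

Lemma sum_card_class : (#|S| + \sum_(t in Q) #|lab_class t|)%N = #|G|.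
Proof.
rewrite -(cardC (mem S)); congr (_ + _)%N.
rewrite -sum1_card (partition_big lab (mem Q)) //=; apply: eq_bigr => t _.
by rewrite -sum1_card; apply: eq_bigl => v; rewrite !inE.
Qed.

Lemma card_class_gt0 t : t \in Q -> (0 < #|lab_class t|)%N.
Proof.
by move=> /lab_onto[v vS <-]; apply/card_gt0P; exists v; rewrite inE vS eqxx.
Qed.

(** Each class other than that of [t] has at least one vertex; the successor accounts for [t] itself
    being counted in [Q]. *)
Lemma card_class_le t : t \in Q -> (#|S| + #|lab_class t| + #|Q| <= #|G|.+1)%N.
Proof.
move=> tQ; rewrite -sum_card_class (bigD1 t) //=.
rewrite (cardsD1 t Q) tQ add1n addnS ltnS -addnA !leq_add2l.
rewrite -sum1_card; apply: (@leq_trans (\sum_(i in Q :\ t) #|lab_class i|)).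
  by apply: leq_sum => i; rewrite !inE => /andP[_ /card_class_gt0].
rewrite leq_eqVlt; apply/orP; left; apply/eqP.
by apply: eq_bigl => i; rewrite !inE andbC.
Qed.

Lemma degree_split (v : G) : degree v = (#|in_nbrs v| + #|out_nbrs v|)%N.
Proof.
rewrite /degree -(cardsID S); congr (_ + _)%N.
  by apply: eq_card => u; rewrite !inE.
by apply: eq_card => u; rewrite !inE andbC.
Qed.

Lemma in_nbrs_sub v : in_nbrs v \subset S.
Proof. by apply/subsetP => u; rewrite inE => /andP[]. Qed.

Lemma out_nbrs_sub v : v \notin S -> out_nbrs v \subset lab_class (lab v) :\ v.
Proof.
move=> vS; apply/subsetP => u; rewrite !inE => /andP[vu uS].
rewrite uS (edge_lab v u) // eqxx !andbT.
by apply/eqP => uv; rewrite uv edge_irr in vu.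
Qed.

Lemma card_class_lab v : v \notin S ->
  #|lab_class (lab v)| = #|lab_class (lab v) :\ v|.+1.
Proof. by move=> vS; rewrite (cardsD1 v) inE vS eqxx. Qed.

Lemma card_out_nbrs v : v \notin S -> (#|out_nbrs v| < #|lab_class (lab v)|)%N.
Proof. by move=> vS; rewrite card_class_lab // ltnS subset_leq_card // out_nbrs_sub. Qed.

Lemma Aop_cut_out (xi : T -> R) (v : G) : v \notin S ->
  Aop a (cut_vector xi) v =
  (a * #|in_nbrs v|%:R + #|out_nbrs v|%:R) * xi (lab v) + (1 - a) * #|in_nbrs v|%:R.
Proof.
move=> vS; rewrite /Aop degree_split natrD /cut_vector (negPf vS).
have -> : \sum_(u | edge v u) (if u \in S then 1 else xi (lab u)) =
    #|in_nbrs v|%:R + #|out_nbrs v|%:R * xi (lab v).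
  rewrite (bigID (mem S)) /=; congr (_ + _).
    rewrite -sumr_const; apply: eq_big => [u|u /andP[_ ->] //].
    by rewrite inE.
  rewrite mulr_natl -sumr_const; apply: eq_big => [u|u /andP[vu uS]].
    by rewrite inE.
  by rewrite (negPf uS) (edge_lab v u).
ring.
Qed.

(** The worst case is a vertex adjacent to all others. *)
Lemma Aop_cut_in (xi : T -> R) (v : G) :
  (forall t, t \in Q -> 0 <= xi t) -> v \in S ->
  Aop a (cut_vector xi) v <= a * (#|G|%:R - 1) + (1 - a) * (#|S|%:R - 1)
    + (1 - a) * \sum_(t in Q) #|lab_class t|%:R * xi t.
Proof.
move=> xi0 vS; have /andP[a0 a1] := a01.
have X0 u : 0 <= cut_vector xi u.
  rewrite /cut_vector; case: ifPn => // /lab_mem; exact: xi0.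
rewrite -addrA -mulrDr /Aop {1}/cut_vector vS mulr1; apply: lerD.
  apply: ler_wpM2l => //; rewrite lerBrDr natr1 ler_nat.
  rewrite /degree -add1n -(cards1 v) -cardsT.
  rewrite -cardsUI [X in (_ + X)%N](_ : _ = 0%N); last first.
    apply/eqP; rewrite cards_eq0; apply/eqP/setP => u; rewrite !inE.
    by apply/andP => -[/eqP->]; rewrite edge_irr.
  by rewrite addn0 subset_leq_card // subsetT.
apply: ler_wpM2l; first by lra.
have -> : #|S|%:R - 1 + \sum_(t in Q) #|lab_class t|%:R * xi t
    = \sum_(u | u != v) cut_vector xi u.
  rewrite -sum_lab; apply: (addrI (cut_vector xi v)).
  transitivity (\sum_u cut_vector xi u); last by rewrite (bigD1 v).
  rewrite [RHS](bigID (mem S)) /= {1}/cut_vector vS addrA.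
  congr (_ + _).
    rewrite addrC subrK -sumr_const; apply: eq_bigr => u uS.
    by rewrite /cut_vector uS.
  by apply: eq_bigr => u uS; rewrite /cut_vector (negPf uS).
rewrite [leRHS](bigID (edge v)) /= -[leLHS]addr0; apply: lerD; last first.
  exact: sumr_ge0.
rewrite le_eqVlt; apply/orP; left; apply/eqP; apply: eq_bigl => u.
by case: eqP => //= ->; rewrite edge_irr.
Qed.

Lemma degree_no_cut (v : G) : S = set0 -> (2 <= #|Q|)%N -> (degree (v : G) + 2 <= #|G|)%N.
Proof.
move=> S0 Q2; have vS : v \notin S by rewrite S0 inE.
have := card_class_le _ (lab_mem v vS).
have := card_out_nbrs v vS; have := subset_leq_card (in_nbrs_sub v).
rewrite degree_split S0 cards0; lia.
Qed.

Lemma rho_no_cut : S = set0 -> (2 <= #|Q|)%N -> rho_alpha a G <= #|G|%:R - 2.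
Proof.
move=> S0 Q2.
have G0 : (0 < #|G|)%N.
  have [t tQ] : exists t, t \in Q by apply/card_gt0P; lia.
  by have [v _ _] := lab_onto _ tQ; apply/card_gt0P; exists v.
apply: (@rho_alpha_le _ a _ _ (fun=> 1)) => // v.
rewrite /Aop -natr_degree !mulr1 -mulrDl addrC subrK mul1r.
by rewrite lerBrDr -natrD ler_nat degree_no_cut.
Qed.

(** * The weights for a target value and their slack *)

Variable c : R.
Hypothesis S_gt0 : (0 < #|S|)%N.
Hypothesis S_lt : (#|S| < #|Q|)%N.
Hypothesis c_ge : #|G|%:R - 2 <= c.

Let n : R := #|G|%:R.
Let s : R := #|S|%:R.
Let m (t : T) : R := #|lab_class t|%:R.
(** [K - m] is the denominator of the weight on a class of size [m]. [M] bounds the class sizes,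
    since there are at least [s + 1] classes. *)
Let K : R := c - a * s + 1.
Let M : R := n - 2 * s.
Let q : R := #|Q|%:R.

(** Solves the eigenvalue equation at a vertex adjacent to all of [S] and to the rest of its
    class. *)
Definition cut_weight (t : T) : R := (1 - a) * s / (K - m t).

Let s1 : 1 <= s. Proof. by rewrite ler1n. Qed.

Let sq : s + 1 <= q. Proof. by rewrite natr1 ler_nat. Qed.

Let m1 t : t \in Q -> 1 <= m t.
Proof. by move=> tQ; rewrite ler1n card_class_gt0. Qed.

Let mM t : t \in Q -> m t <= M.
Proof.
move=> tQ; rewrite /M lerBrDr /m /s -natrM -natrD ler_nat.
have := card_class_le _ tQ; lia.
Qed.

(** From [n - 2 <= c] one gets [K - M >= (1 - a) * s + (s - 1)]. *)
Let KM : 0 < K - M.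
Proof.
have /andP[a0 a1] := a01; move: c_ge; rewrite -/n /K /M => cn.
have : 0 < (1 - a) * s by rewrite mulr_gt0 //; move: s1; lra.
rewrite mulrBl mul1r; move: s1; lra.
Qed.

Let Km t : t \in Q -> 0 < K - m t.
Proof. by move=> /mM; move: KM; lra. Qed.

Let Q_mem : exists t, t \in Q.
Proof. by apply/card_gt0P; apply: leq_ltn_trans S_lt. Qed.

Let M1 : 1 <= M.
Proof. have [t tQ] := Q_mem; exact: le_trans (m1 _ tQ) (mM _ tQ). Qed.

Let K1 : 0 < K - 1. Proof. by move: M1 KM; lra. Qed.

Let b0 : 0 < 1 - a. Proof. by have /andP[a0 a1] := a01; lra. Qed.

Lemma cut_weight_gt0 t : t \in Q -> 0 < cut_weight t.
Proof.
move=> tQ; rewrite divr_gt0 ?Km // mulr_gt0 //; move: s1; lra.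
Qed.

(* By convexity of [m / (K - m)], the classes contribute the most when one
   of them has [M] elements and there are [s] others, all singletons. *)
Lemma cut_weight_excess :
  s * ((1 - a) * s / (c - a * s)) + M * ((1 - a) * s / (K - M))
    - \sum_(t in Q) m t * cut_weight t =
  (1 - a) * s / ((K - 1) * (K - M)) *
    ((q - s - 1) * M + \sum_(t in Q) K * (m t - 1) * (M - m t) / (K - m t)).
Proof.
have cK : c - a * s = K - 1 by rewrite /K; ring.
(* The chord through the sizes 1 and [M], minus the deviation from it. *)
have e t : t \in Q -> m t * cut_weight t =
    (1 - a) * s / (K - 1) * (1 - K / (K - M))
    + (1 - a) * s / (K - 1) * (K / (K - M)) * m t
    - (1 - a) * s / ((K - 1) * (K - M)) * (K * (m t - 1) * (M - m t) / (K - m t)).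
  move=> tQ; rewrite /cut_weight; field.
  by rewrite !gt_eqF ?Km.
rewrite (eq_bigr _ e) sumrB big_split /= sumr_const -!mulr_sumr -mulr_natr -/q.
have -> : \sum_(t in Q) m t = n - s.
  by rewrite /n -sum_card_class natrD addrAC subrr add0r natr_sum.
rewrite cK /M; field; rewrite -/M.
by rewrite !gt_eqF.
Qed.

Let excess_ge0 t : t \in Q -> 0 <= K * (m t - 1) * (M - m t) / (K - m t).
Proof.
move=> tQ; rewrite divr_ge0 ?(ltW (Km _ tQ)) //.
have := m1 _ tQ; have := mM _ tQ => h1 h2.
by rewrite !mulr_ge0 // ?subr_ge0 //; move: K1; lra.
Qed.

Let factor_gt0 : 0 < (1 - a) * s / ((K - 1) * (K - M)).
Proof. by rewrite divr_gt0 ?mulr_gt0 //; move: s1; lra. Qed.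

(** The slack off [S] is expressed by the neighbours missing in [S] and in the class, so that it
    vanishes only if none is missing. *)
Lemma Aop_cut_vector_out v : v \notin S ->
  c * cut_vector cut_weight v - Aop a (cut_vector cut_weight) v =
  (1 - a) * (s - #|in_nbrs v|%:R)
  + (a * (s - #|in_nbrs v|%:R) + (m (lab v) - 1 - #|out_nbrs v|%:R))
    * cut_weight (lab v).
Proof.
move=> vS; rewrite Aop_cut_out // /cut_vector (negPf vS).
have wE : (K - m (lab v)) * cut_weight (lab v) = (1 - a) * s.
  by rewrite mulrC divfK // gt_eqF ?Km // lab_mem.
apply/eqP; rewrite -subr_eq0; apply/eqP.
transitivity ((K - m (lab v)) * cut_weight (lab v) - (1 - a) * s).
  by rewrite /K; ring.
by rewrite wE subrr.
Qed.

Let in_le v : #|in_nbrs v|%:R <= s.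
Proof. by rewrite ler_nat subset_leq_card // in_nbrs_sub. Qed.

Let out_le v : v \notin S -> 0 <= m (lab v) - 1 - #|out_nbrs v|%:R.
Proof.
by move=> vS; rewrite -addrA -opprD subr_ge0 addrC natr1 ler_nat card_out_nbrs.
Qed.

Lemma cut_boundE : cut_bound a s n c =
  a * (n - 1) + (1 - a) * (s - 1) + (1 - a) *
    (s * ((1 - a) * s / (c - a * s)) + M * ((1 - a) * s / (K - M))).
Proof. by []. Qed.

(** The excess is kept explicit for the equality case. *)
Lemma Aop_cut_vector_in v : v \in S ->
  Aop a (cut_vector cut_weight) v <= cut_bound a s n c - (1 - a) *
   ((1 - a) * s / ((K - 1) * (K - M)) *
    ((q - s - 1) * M + \sum_(t in Q) K * (m t - 1) * (M - m t) / (K - m t))).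
Proof.
move=> vS; rewrite -cut_weight_excess cut_boundE.
have := Aop_cut_in cut_weight v (fun t tQ => ltW (cut_weight_gt0 t tQ)) vS.
rewrite -/n -/s -/m => h; apply: le_trans h _.
rewrite le_eqVlt; apply/orP; left; apply/eqP; ring.
Qed.

Let total_excess_ge0 :
  0 <= (q - s - 1) * M + \sum_(t in Q) K * (m t - 1) * (M - m t) / (K - m t).
Proof.
apply: addr_ge0; last exact: sumr_ge0.
by rewrite mulr_ge0 //; move: sq M1; lra.
Qed.

Lemma cut_vector_gt0 v : 0 < cut_vector cut_weight v.
Proof.
by rewrite /cut_vector; case: ifPn => // vS; rewrite cut_weight_gt0 ?lab_mem.
Qed.

Lemma Aop_cut_vector_le : cut_bound a s n c <= c ->
  forall v, Aop a (cut_vector cut_weight) v <= c * cut_vector cut_weight v.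
Proof.
move=> cb v; have /andP[a0 _] := a01; have [vS|vS] := boolP (v \in S).
  apply: le_trans (Aop_cut_vector_in v vS) _.
  rewrite /cut_vector vS mulr1; apply: le_trans cb; rewrite gerBl.
  exact: mulr_ge0 (ltW b0) (mulr_ge0 (ltW factor_gt0) total_excess_ge0).
rewrite -subr_ge0 Aop_cut_vector_out //.
have in0 : 0 <= s - #|in_nbrs v|%:R by rewrite subr_ge0.
apply: addr_ge0; first by rewrite mulr_ge0 // ltW.
apply: mulr_ge0; last by rewrite ltW // cut_weight_gt0 // lab_mem.
by rewrite addr_ge0 ?mulr_ge0 ?out_le.
Qed.

Lemma rho_cut_le : cut_bound a s n c <= c -> rho_alpha a G <= c.
Proof.
move=> cb; apply: (@rho_alpha_le _ a c G (cut_vector cut_weight)) => //.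
- by apply: leq_trans S_gt0 (max_card _).
- exact: cut_vector_gt0.
- exact: Aop_cut_vector_le.
Qed.

(** By [eigenvalue_eq] every slack vanishes. On [S] this fixes the number of classes and puts each
    size at an end of the chord; off [S] it forces all permitted edges. *)
Lemma cut_extremal_eq : connected G -> #|S| = 1%N -> cut_bound a s n c <= c ->
  eigenvalue (A_alpha a G) c ->
  [/\ #|Q| = 2%N,
      forall t, t \in Q -> #|lab_class t| = 1%N \/ m t = M,
      forall v, v \notin S -> in_nbrs v = S
    & forall v, v \notin S -> out_nbrs v = lab_class (lab v) :\ v].
Proof.
move=> cG S1 cb ec; have /andP[a0 a1] := a01.
have eqA := eigenvalue_eq a c G _ a01 cG cut_vector_gt0 (Aop_cut_vector_le cb) ec.
have [z zS] : exists z, z \in S by apply/card_gt0P.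
have ez : (q - s - 1) * M + \sum_(t in Q) K * (m t - 1) * (M - m t) / (K - m t) = 0.
  apply/eqP; rewrite eq_le total_excess_ge0 andbT.
  have := Aop_cut_vector_in z zS; rewrite eqA /cut_vector zS mulr1 => h.
  have : (1 - a) * ((1 - a) * s / ((K - 1) * (K - M)) * ((q - s - 1) * M
     + \sum_(t in Q) K * (m t - 1) * (M - m t) / (K - m t))) <= 0.
    move: h cb; lra.
  by rewrite pmulr_rle0 // pmulr_rle0.
have qM : 0 <= (q - s - 1) * M by rewrite mulr_ge0 //; move: sq M1; lra.
have se : 0 <= \sum_(t in Q) K * (m t - 1) * (M - m t) / (K - m t).
  exact: sumr_ge0.
have [qM0 se0] : (q - s - 1) * M = 0 /\
    \sum_(t in Q) K * (m t - 1) * (M - m t) / (K - m t) = 0.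
  by split; move: ez qM se; lra.
have nbrs v (vS : v \notin S) :
    #|in_nbrs v|%:R = s /\ m (lab v) - 1 - #|out_nbrs v|%:R = 0.
  have := Aop_cut_vector_out v vS; rewrite eqA subrr => h.
  have in0 : 0 <= s - #|in_nbrs v|%:R by rewrite subr_ge0.
  have w0 := cut_weight_gt0 _ (lab_mem v vS).
  have h1 : 0 <= (1 - a) * (s - #|in_nbrs v|%:R) by rewrite mulr_ge0 // ltW.
  have h2 : 0 <= (a * (s - #|in_nbrs v|%:R) + (m (lab v) - 1 - #|out_nbrs v|%:R))
    * cut_weight (lab v).
    by rewrite mulr_ge0 ?(ltW w0) // addr_ge0 ?mulr_ge0 ?out_le.
  have h3 : (1 - a) * (s - #|in_nbrs v|%:R) = 0 by move: h h1 h2; lra.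
  have h4 : (a * (s - #|in_nbrs v|%:R) + (m (lab v) - 1 - #|out_nbrs v|%:R))
    * cut_weight (lab v) = 0 by move: h h1 h2; lra.
  have {}h3 : s - #|in_nbrs v|%:R = 0.
    by apply: (mulfI (lt0r_neq0 b0)); rewrite h3 mulr0.
  split; first by move/eqP: h3; rewrite subr_eq0 => /eqP <-.
  by apply: (mulIf (lt0r_neq0 w0)); rewrite mul0r -h4 h3 mulr0 add0r.
split.
- move/eqP: qM0; rewrite mulf_eq0 (gt_eqF (lt_le_trans ltr01 M1)) orbF.
  rewrite /s S1 -addrA -opprD subr_eq0 -(natrD _ 1 1) eqr_nat => /eqP; exact.
- move=> t tQ; have /eqP := psumr_eq0P excess_ge0 se0 tQ.
  rewrite !mulf_eq0 invr_eq0 (gt_eqF (Km _ tQ)) orbF.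
  have K0 : K != 0 by rewrite gt_eqF //; move: K1; lra.
  rewrite (negPf K0) /= => /orP[|]; rewrite subr_eq0 => /eqP h; [left|right] => //.
  by apply/eqP; rewrite -(eqr_nat R) -/(m t) h.
- move=> v vS; apply/eqP; rewrite eqEcard in_nbrs_sub /= -(ler_nat R).
  by rewrite (proj1 (nbrs v vS)).
- move=> v vS; apply/eqP; rewrite eqEcard out_nbrs_sub //= -(ler_nat R).
  have := proj2 (nbrs v vS); rewrite /m card_class_lab // -natr1; lra.
Qed.

End Cut.

(** * Recognizing the extremal graph *)

(** A hub and a pendant vertex determine the edges, so any bijection respecting both marks is an
    isomorphism. Two transpositions correct an arbitrary bijection. *)
Lemma iso_of_two_marked (G H : sgraph) (z p : G) (z' p' : H) :
  #|G| = #|H| -> z != p -> z' != p' ->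
  (forall x y, edge x y = (x != y) && [|| x == z, y == z | (x != p) && (y != p)]) ->
  (forall x y, edge x y = (x != y) && [|| x == z', y == z' | (x != p') && (y != p')]) ->
  iso G H.
Proof.
move=> GH zp zp' eG eH.
pose h0 (x : G) : H := enum_val (cast_ord GH (enum_rank x)).
have h0_bij : bijective h0.
  exists (fun y => enum_val (cast_ord (esym GH) (enum_rank y))) => x.
    by rewrite /h0 enum_valK cast_ordK enum_rankK.
  by rewrite /h0 enum_valK cast_ordKV enum_rankK.
pose h1 x := tperm (h0 z) z' (h0 x).
pose h x := tperm (h1 p) p' (h1 x).
have h1_inj : injective h1 by move=> x y /perm_inj /(bij_inj h0_bij).
have h_inj : injective h by move=> x y /perm_inj /h1_inj.
have h1z : h1 z = z' by rewrite /h1 tpermL.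
have hp : h p = p' by rewrite /h tpermL.
have hz : h z = z'.
  rewrite /h h1z tpermD // 1?eq_sym // -h1z.
  by apply: contra zp => /eqP /h1_inj ->.
exists h; split; first by apply: inj_card_bij; rewrite ?GH.
by move=> x y; rewrite eH eG -hz -hp !(inj_eq h_inj).
Qed.

(** A vertex is labelled by the root of its component; the option type provides [None] for the
    vertices of [S]. *)
Lemma cut_labelling (G : sgraph) (S : {set G}) :
  exists (T : finType) (lab : G -> T) (Q : {set T}),
  [/\ forall v, v \notin S -> lab v \in Q,
      forall t, t \in Q -> exists2 v, v \notin S & lab v = t,
      forall u v, u \notin S -> v \notin S -> edge u v -> lab u = lab v
    & #|Q| = components (del S)].
Proof.
pose D := del S; pose rt := fingraph.root (@edge D).
have sD : connect_sym (@edge D) := sym_connect_sym (@edge_sym D).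
pose lab v : option D := omap rt (insub v).
have labE v (vS : v \notin S) : lab v = Some (rt (Sub v vS)).
  by rewrite /lab insubT.
exists (option D : finType), lab, [set Some d | d in fingraph.roots (@edge D)].
split.
- by move=> v vS; rewrite labE; apply/imset_f/roots_root.
- move=> _ /imsetP[d /eqP rd ->]; exists (val d); first exact: (valP d).
  by rewrite /lab valK /= /rt rd.
- move=> u v uS vS uv; rewrite !labE; congr Some.
  by apply/(fingraph.rootP sD)/connect1.
rewrite card_imset; last by move=> x y [].
by apply: eq_card => d; rewrite !inE andbT.
Qed.

Lemma edge_extremal (n : nat) (x y : extremal n) :
  edge x y = (x != y) && [|| x == inl ord0, y == inl ord0
    | (x != inr (inr ord0)) && (y != inr (inr ord0))].
Proof.
case: x => [i|[i|i]]; case: y => [j|[j|j]] //=;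
  rewrite ?(ord1 i) ?(ord1 j) ?eqxx //=.
by rewrite andbT.
Qed.

(** The vertex of [S] is the hub, a singleton class is the pendant vertex, and the other class is
    the clique. *)
Lemma iso_extremal (G : sgraph) (S : {set G}) (T : finType) (lab : G -> T)
    (Q : {set T}) :
  (4 <= #|G|)%N -> #|S| = 1%N -> #|Q| = 2%N ->
  (forall v, v \notin S -> lab v \in Q) ->
  (forall t, t \in Q ->
     #|lab_class G S T lab t| = 1%N \/ (#|lab_class G S T lab t| + 2 = #|G|)%N) ->
  (forall v, v \notin S -> in_nbrs G S v = S) ->
  (forall v, v \notin S -> out_nbrs G S v = lab_class G S T lab (lab v) :\ v) ->
  iso G (extremal #|G|).
Proof.
move=> G4 S1 /eqP/cards2P[t1 [t2 [t12 QE]]] labQ sizes inS outS.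
have sumG := sum_card_class G S T lab Q labQ.
move: sumG; rewrite S1 QE big_setU1 ?inE //= big_set1 => sumG.
have [t [t' [tQ cl1]]] : exists t t', [/\ Q = [set t; t']
   & #|lab_class G S T lab t| = 1%N].
  have t1Q : t1 \in Q by rewrite QE !inE eqxx.
  have t2Q : t2 \in Q by rewrite QE !inE eqxx orbT.
  have [h1|h1] := sizes t1 t1Q; first by exists t1, t2.
  have [h2|h2] := sizes t2 t2Q; last first.
    (* Two classes of size [#|G| - 2] would force [#|G| = 3]. *)
    by move: h1 h2 sumG G4; move: #|G| #|_ t1| #|_ t2|; lia.
  by exists t2, t1; rewrite setUC.
have /cards1P[p pE] : #|lab_class G S T lab t| == 1%N by apply/eqP.
have /cards1P[z zE] : #|S| == 1%N by apply/eqP.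
have inSE v : (v \in S) = (v == z) by rewrite zE inE.
have clp v : v != z -> (lab v == t) = (v == p).
  by move=> vz; have := in_set1 v p; rewrite -pE inE inSE vz.
have pz : p != z by have := set11 p; rewrite -pE inE inSE => /andP[].
have labt' v : v != z -> v != p -> lab v = t'.
  move=> vz vp; have : lab v \in Q by rewrite labQ // inSE.
  by rewrite tQ !inE clp // (negPf vp) => /eqP.
have edge_z v : v != z -> edge v z.
  move=> vz; have : z \in in_nbrs G S v by rewrite inS inSE.
  by rewrite inE => /andP[].
have edge_out u v : u != z -> v != z -> edge u v = (u != v) && (lab u == lab v).
  move=> uz vz; have : (v \in out_nbrs G S u) = (v \in lab_class G S T lab (lab u) :\ u).
    by rewrite outS // inSE.
  by rewrite !inE !inSE vz andbT /= => ->; rewrite eq_sym [lab v == _]eq_sym.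
apply: (iso_of_two_marked G (extremal #|G|) z p (inl ord0) (inr (inr ord0))) => //.
- by rewrite card_extremal //; lia.
- by rewrite eq_sym.
- move=> x y; have [->|xy] := eqVneq x y; first by rewrite edge_irr.
  have [xz|xz] := eqVneq x z.
    by rewrite xz edge_sym edge_z // -xz eq_sym.
  have [yz|yz] := eqVneq y z; first by rewrite yz edge_z.
  rewrite edge_out // xy /=.
  have [xp|xp] := eqVneq x p.
    have /eqP -> : lab x == t by rewrite clp // xp.
    by rewrite eq_sym clp // -xp eq_sym (negPf xy).
  have [yp|yp] := eqVneq y p.
    have /eqP -> : lab y == t by rewrite clp // yp.
    by rewrite clp // (negPf xp).
  by rewrite !labt' // eqxx.
- exact: edge_extremal.
Qed.

(** * Toughness by the size of a violating cut *)

Theorem theorem1p1 (R : realType) (alpha : R) (n : nat) :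
  0 <= alpha < 1 ->
  f alpha <= n%:R ->
  (forall G : sgraph,
     connected G -> #|G| = n ->
     rho_alpha alpha (extremal n) <= rho_alpha alpha G ->
     ~ iso G (extremal n) -> tough (1 : R) G) /\
  largest_root (cubic alpha n) (rho_alpha alpha (extremal n)).
Proof.
move=> a01 fn; have /andP[a0 a1] := a01.
have [n6 _] := f_le_cases alpha n a01 fn.
have n3 : (3 <= n)%N by lia.
have [rho_gt rho_root] : n%:R - 2 < rho_alpha alpha (extremal n) /\
    root (cubic alpha n) (rho_alpha alpha (extremal n)).
  by apply: rho_extremal_gt => //; [lra|exact: cubic_lt0].
split; last first.
  (* A root above [n - 2] equals the radius, and any other root is smaller. *)
  split=> // y ry; have [yn|yn] := lerP y (n%:R - 2).
    exact: le_trans yn (ltW rho_gt).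
  by rewrite (rho_extremal alpha y n).
move=> G cG Gn rhoG niso S S2; rewrite mul1r ler_nat leqNgt; apply/negP => SQ.
have [T [lab [Q [labQ Qlab edge_lab QE]]]] := cut_labelling G S.
rewrite -QE in S2 SQ.
have [S0|[S1|S_ge2]] : #|S| = 0%N \/ #|S| = 1%N \/ (2 <= #|S|)%N by lia.
- have := rho_no_cut R alpha G S T lab Q a01 labQ Qlab edge_lab (cards0_eq S0) S2.
  rewrite Gn; move: rho_gt rhoG; lra.
- have S_gt0 : (0 < #|S|)%N by rewrite S1.
  have c_ge : #|G|%:R - 2 <= rho_alpha alpha (extremal n) by rewrite Gn ltW.
  have cb : cut_bound alpha #|S|%:R #|G|%:R (rho_alpha alpha (extremal n))
      <= rho_alpha alpha (extremal n).
    by rewrite S1 Gn cut_bound_root.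
  have rho_le := rho_cut_le R alpha G S T lab Q a01 labQ Qlab edge_lab _ S_gt0 SQ c_ge cb.
  have G0 : (0 < #|G|)%N by rewrite Gn; lia.
  have [rho_eig _] := rho_alphaP alpha G0.
  have rhoE : rho_alpha alpha G = rho_alpha alpha (extremal n).
    by apply/eqP; rewrite eq_le rho_le.
  rewrite rhoE in rho_eig.
  have [Q2 sizes inS outS] := cut_extremal_eq R alpha G S T lab Q a01 labQ Qlab
    edge_lab _ S_gt0 SQ c_ge cG S1 cb rho_eig.
  apply: niso; rewrite -Gn; apply: (iso_extremal G S T lab Q) => //.
    by rewrite Gn; lia.
  move=> t /sizes[|h]; [by left|right].
  apply/eqP; rewrite -(eqr_nat R) natrD h S1; apply/eqP; ring.
- have S_gt0 : (0 < #|S|)%N by lia.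
  (* A nonempty class and at least [#|S| + 1] classes leave room for this in [card_class_le]. *)
  have Sn : (#|S| + #|S| < n)%N.
    have [t tQ] : exists t, t \in Q by apply/card_gt0P; lia.
    have := card_class_le G S T lab Q labQ Qlab t tQ.
    have := card_class_gt0 G S T lab Q Qlab t tQ; rewrite Gn; lia.
  have [c [c_ge c_lt cb]] := extremal_gap alpha n #|S| a01 fn S_ge2 Sn.
  rewrite -Gn in c_ge cb.
  have := rho_cut_le R alpha G S T lab Q a01 labQ Qlab edge_lab c S_gt0 SQ c_ge cb.
  by move: c_lt rhoG; lra.
Qed.
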